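(* For $d=0,1,\ldots,6$, let $f_d(x)=\sum_{n=0}^{\infty}\mathrm{pnw}(n,d)x^n$. Then, as formal power series, \begin{align*} f_0(x)&=\frac{1}{1-x}, & f_1(x)&=\frac{x}{1-x},\\ f_2(x)&=\frac{x^2}{(1-x)^2}, & f_3(x)&=\frac{x^3}{(1-x^2)(1-x)^2},\\ f_4(x)&=\frac{x^4}{(1-x^3)(1-x)^3}, & f_5(x)&=\frac{x^5(1+x+x^2)}{(1-x^4)(1-x^2)^2(1-x)^2},\\ f_6(x)&=\frac{x^6(1+x+x^2+x^3)}{(1-x^5)(1-x^3)(1-x^2)(1-x)^3}. \end{align*}
   Context: A binary word $w$ is prefix normal if for every $1\le i\le |w|$, no (contiguous) substring of $w$ of length $i$ contains more $1$s than the prefix of $w$ of length $i$ (the empty word is prefix normal). The density of $w$ is its number of $1$s. $\mathrm{pnw}(n,d)$ denotes the number of prefix normal words of length $n$ and density $d$. *)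

(* Defs.v *)
From HB Require Import structures.
From mathcomp Require Import all_boot all_order all_algebra.
From mathcomp Require Import boolp.

Set Implicit Arguments.
Unset Strict Implicit.
Unset Printing Implicit Defensive.

Import GRing.Theory.

Local Open Scope nat_scope.

(* Words are bit sequences, [true] standing for the letter 1. *)
Definition density (w : seq bool) : nat := count_mem true w.

Definition prefix_normal (w : seq bool) : bool :=
  [forall i : 'I_(size w).+1, (1 <= i) ==>
    [forall u : i.-tuple bool,
      infix u w ==> (density u <= density (take i w))]].

Definition pnw (n d : nat) : nat :=
  #|[set w : n.-tuple bool | prefix_normal w && (density w == d)]|.

Local Open Scope ring_scope.

(* [Series a] is the formal power series \sum_n a n * x ^ n. It is a wrapper,
   so that the pointwise structures on functions do not interfere. *)
Record fps (R : Type) := Series { coefs : nat -> R }.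

HB.instance Definition _ (R : Type) := gen_eqMixin (fps R).
HB.instance Definition _ (R : Type) := gen_choiceMixin (fps R).

Lemma fpsP (R : Type) (f g : fps R) : coefs f =1 coefs g -> f = g.
Proof. by case: f g => [a] [b] /= /funext ->. Qed.

Section Zmodule.
Variable R : zmodType.
Implicit Types f g h : fps R.

Definition fps_zero : fps R := Series (fun=> 0).
Definition fps_opp f : fps R := Series (fun n => - coefs f n).
Definition fps_add f g : fps R := Series (fun n => coefs f n + coefs g n).

Fact fps_addA : associative fps_add.
Proof. by move=> f g h; apply: fpsP => n; apply: addrA. Qed.

Fact fps_addC : commutative fps_add.
Proof. by move=> f g; apply: fpsP => n; apply: addrC. Qed.

Fact fps_add0 : left_id fps_zero fps_add.
Proof. by move=> f; apply: fpsP => n; apply: add0r. Qed.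

Fact fps_addN : left_inverse fps_zero fps_opp fps_add.
Proof. by move=> f; apply: fpsP => n; apply: addNr. Qed.

HB.instance Definition _ :=
  GRing.isZmodule.Build (fps R) fps_addA fps_addC fps_add0 fps_addN.

End Zmodule.

Section ComRing.
Variable R : comNzRingType.
Implicit Types f g h : fps R.

Definition fps_one : fps R := Series (fun n => (n == 0)%:R).
Definition fps_mul f g : fps R :=
  Series (fun n => \sum_(i < n.+1) coefs f i * coefs g (n - i)%N).

Let trunc m f : {poly R} := \poly_(i < m) coefs f i.

Let fps_mul_trunc m f g n : (n < m)%N ->
  coefs (fps_mul f g) n = (trunc m f * trunc m g)`_n.
Proof.
move=> ltnm; rewrite coefM /=; apply: eq_bigr => i _.
rewrite !coef_poly (leq_ltn_trans (leq_subr i n) ltnm).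
by rewrite (leq_ltn_trans _ ltnm) // -ltnS.
Qed.

Fact fps_mulC : commutative fps_mul.
Proof.
by move=> f g; apply: fpsP => n; rewrite !(fps_mul_trunc _ _ (ltnSn n)) mulrC.
Qed.

Fact fps_mulA : associative fps_mul.
Proof.
have E f g h n : coefs (fps_mul f (fps_mul g h)) n
    = (trunc n.+1 f * (trunc n.+1 g * trunc n.+1 h))`_n.
  rewrite coefM /=; apply: eq_bigr => i _; congr (_ * _).
    by rewrite coef_poly ltn_ord.
  by rewrite -fps_mul_trunc // ltnS leq_subr.
move=> f g h; apply: fpsP => n.
by rewrite (fps_mulC (fps_mul f g)) !E mulrA mulrC.
Qed.

Fact fps_mul1 : left_id fps_one fps_mul.
Proof.
move=> f; apply: fpsP => n /=.
rewrite big_ord_recl /= mul1r subn0 big1 ?addr0 // => i _.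
by rewrite mul0r.
Qed.

Fact fps_mulDl : left_distributive fps_mul +%R.
Proof.
move=> f g h; apply: fpsP => n /=.
by rewrite -big_split /=; apply: eq_bigr => i _; rewrite mulrDl.
Qed.

Fact fps_one_neq0 : fps_one != 0.
Proof.
apply/eqP => /(congr1 (fun f => coefs f 0)) /= /eqP.
by rewrite oner_eq0.
Qed.

HB.instance Definition _ :=
  GRing.Zmodule_isComNzRing.Build (fps R)
    fps_mulA fps_mulC fps_mul1 fps_mulDl fps_one_neq0.

Definition fpsX : fps R := Series (fun n => (n == 1)%:R).

End ComRing.

Section ComUnitRing.
Variable R : comUnitRingType.
Implicit Types f g h : fps R.

Definition fps_unit : {pred fps R} := fun f => coefs f 0 \is a GRing.unit.

(* The first [n] coefficients of the inverse of [f]: the [n]-th one is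
   - (f_0)^-1 * \sum_(i < n) f_(n - i) * b_i. *)
Fixpoint inv_coefs f (n : nat) : seq R :=
  if n is m.+1 then
    let b := inv_coefs f m in
    rcons b (if m is 0 then (coefs f 0)^-1
             else - (coefs f 0)^-1 * \sum_(i < m) coefs f (m - i)%N * b`_i)
  else [::].

(* As everywhere in the unit ring hierarchy, the inverse of a non-unit is
   itself. *)
Definition fps_inv f : fps R :=
  if f \in fps_unit then Series (fun n => (inv_coefs f n.+1)`_n) else f.

Let size_inv_coefs f n : size (inv_coefs f n) = n.
Proof. by elim: n => //= n IHn; rewrite size_rcons IHn. Qed.

Let nth_inv_coefs f m n : (n < m)%N ->
  (inv_coefs f m)`_n = (inv_coefs f n.+1)`_n.
Proof.
elim: m => // m IHm; rewrite ltnS leq_eqVlt => /predU1P[-> // | ltnm].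
by rewrite [inv_coefs f m.+1]/= nth_rcons size_inv_coefs ltnm IHm.
Qed.

Fact fps_mulVf : {in fps_unit, left_inverse 1 fps_inv *%R}.
Proof.
move=> f Uf; rewrite /fps_inv Uf; apply: fpsP => n.
have {}Uf : coefs f 0 \is a GRing.unit by [].
change (\sum_(i < n.+1) (inv_coefs f i.+1)`_i * coefs f (n - i)%N = (n == 0)%:R).
rewrite big_ord_recr /= subnn nth_rcons size_inv_coefs ltnn eqxx.
case: n => [|n]; first by rewrite big_ord0 add0r mulVr.
rewrite mulrAC mulNr mulVr // mulN1r; apply/eqP; rewrite subr_eq0; apply/eqP.
apply: eq_bigr => i _; rewrite mulrC; congr (_ * _).
exact/esym/nth_inv_coefs.
Qed.

Fact fps_unitPl f g : g * f = 1 -> fps_unit f.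
Proof.
move=> /(congr1 (fun h => coefs h 0)) /=.
rewrite big_ord1 /= => gf1.
by apply/unitrPr; exists (coefs g 0); rewrite mulrC.
Qed.

Fact fps_inv_out : {in [predC fps_unit], fps_inv =1 id}.
Proof. by move=> f; rewrite inE /fps_inv => /negbTE ->. Qed.

HB.instance Definition _ :=
  GRing.ComNzRing_hasMulInverse.Build (fps R)
    fps_mulVf fps_unitPl fps_inv_out.

End ComUnitRing.

Definition pnw_series (d : nat) : fps int := Series (fun n => (pnw n d)%:Z).

(* Main.v *)
(** A prefix normal word of density d > 0 starts with 1, so it is
    1 0^(a_1) 1 0^(a_2) ... 1 0^(a_d), and prefix normality says that
    a_1 + ... + a_k <= a_(j+1) + ... + a_(j+k) whenever j + k < d: the shortest
    window with k + 1 ones may be taken to be a prefix. The last gap a_d is free.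
    For d <= 6, putting m = a_1 and b_i = a_i - m >= 0, all these inequalities
    hold automatically, except b_2 <= b_3 + b_4 when d = 5, and
    b_2 <= b_3 + b_4 and b_2 <= b_4 + b_5, i.e. b_2 <= b_4 + min(b_3, b_5),
    when d = 6. Pairs (b_3, b_5) are parametrized by their minimum and their
    signed difference, and the triples with a <= b + c are counted by subtracting
    those with a = b + c + 1 + e. *)

Require Import Defs.
From mathcomp Require Import all_boot all_order all_algebra.
From mathcomp Require Import zify ring.

Set Implicit Arguments.
Unset Strict Implicit.
Unset Printing Implicit Defensive.

Import GRing.Theory.

Local Open Scope nat_scope.

(** * Words encoded by their gaps *)

Definition gap_word (s : seq nat) : seq bool :=
  flatten [seq true :: nseq a false | a <- s].

(* The number of leading 0s of [w], and the numbers of 0s after each of its 1s. *)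
Fixpoint word_gaps (w : seq bool) : nat * seq nat :=
  if w is b :: w' then
    let: (z, s) := word_gaps w' in if b then (0, z :: s) else (z.+1, s)
  else (0, [::]).

Lemma word_gapsK w :
  nseq (word_gaps w).1 false ++ gap_word (word_gaps w).2 = w.
Proof.
elim: w => //= b w; case: (word_gaps w) => z s /= <-.
by case: b.
Qed.

Lemma gap_wordK s : word_gaps (gap_word s) = (0, s).
Proof.
elim: s => //= a s; rewrite -/(gap_word s) => IHs.
suff -> : word_gaps (nseq a false ++ gap_word s) = (a, s) by [].
by elim: a => //= a ->.
Qed.

Lemma gap_word_cat s t : gap_word (s ++ t) = gap_word s ++ gap_word t.
Proof. by rewrite /gap_word map_cat flatten_cat. Qed.

Lemma density_nseq0 n : density (nseq n false) = 0.
Proof. by rewrite /density count_nseq mul0n. Qed.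

Lemma density_gap_word s : density (gap_word s) = size s.
Proof.
rewrite /density; elim: s => //= a s IHs.
by rewrite count_cat IHs count_nseq mul0n add0n add1n.
Qed.

Lemma size_gap_word s : size (gap_word s) = sumn s + size s.
Proof.
by elim: s => //= a s IHs; rewrite size_cat size_nseq IHs -/(gap_word s); lia.
Qed.

(** Counting from 0, the [k]-th 1 stands at position [sumn (take k s) + k]. *)
Lemma density_take_gap_word s m k : k < size s ->
  (k < density (take m (gap_word s))) = (sumn (take k s) + k < m).
Proof.
rewrite /density.
elim: s m k => [//|a s IHs] [|m] [|k] //; rewrite ?ltn0 //= ltnS => ltks.
rewrite -/(gap_word s) take_cat size_nseq; case: (ltnP m a) => [ltma|leam].
  by rewrite take_nseq ?(ltnW ltma) // count_nseq mul0n; lia.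
rewrite count_cat count_nseq mul0n add0n add1n ltnS IHs //; lia.
Qed.

(** * Prefix normality as inequalities between gap sums *)

Lemma prefix_normalP w :
  reflect (forall u : seq bool, infix u w -> density u <= density (take (size u) w))
          (prefix_normal w).
Proof.
apply: (iffP forallP) => [Nw u uw | Nw i].
  have [/size0nil -> // | u_gt0] := posnP (size u).
  have ltuw : size u < (size w).+1 by rewrite ltnS size_infix.
  have /implyP/(_ u_gt0)/forallP/(_ (in_tuple u))/implyP := Nw (Ordinal ltuw).
  exact.
apply/implyP => _; apply/forallP => u; apply/implyP => /Nw.
by rewrite size_tuple.
Qed.

(* The last gap of [s], which carries no constraint, is excluded since
   [j + k < size s]. *)
Definition gap_normal (s : seq nat) : bool :=
  all (fun k => all (fun j => sumn (take k s) <= sumn (take k (drop j s)))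
                    (iota 0 (size s - k)))
      (iota 0 (size s)).

Lemma gap_normalP s :
  reflect (forall j k, j + k < size s ->
             sumn (take k s) <= sumn (take k (drop j s)))
          (gap_normal s).
Proof.
apply: (iffP allP) => [Ns j k ltjk | Ns k].
  have /Ns/allP/(_ j) : k \in iota 0 (size s) by rewrite mem_iota; lia.
  by apply; rewrite mem_iota; lia.
rewrite mem_iota => ltks; apply/allP => j; rewrite mem_iota => ltjs.
by apply: Ns; lia.
Qed.

Lemma prefix_normal_gap_word s : prefix_normal (gap_word s) = gap_normal s.
Proof.
apply/prefix_normalP/gap_normalP => [Ns j k ltjk | Ns u /infixP[p [q Ew]]].
  (* [m] is the length of the window from the [j]-th 1 through the [(j + k)]-th 1, which holds
     [k + 1] ones. *)
  set v := drop j s; set m := (sumn (take k v) + k).+1.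
  have ltkv : k < size v by rewrite size_drop; lia.
  have : infix (take m (gap_word v)) (gap_word s).
    apply/infixP; exists (gap_word (take j s)), (drop m (gap_word v)).
    by rewrite cat_take_drop -gap_word_cat cat_take_drop.
  move/Ns; move: (density_take_gap_word m ltkv); rewrite ltnSn.
  move=> ltk /(leq_trans ltk); rewrite density_take_gap_word; last by lia.
  by rewrite size_take_min; lia.
case Eu: (density u) => [//|k].
(* The [z] zeros that open [u ++ q] are moved to the end of [p]. The cut then falls just before a 1
   or at the end of the word, and so splits [s] as [r ++ v]. *)
have := word_gapsK (u ++ q); case: (word_gaps _) => z v /= Euq.
have := word_gapsK (p ++ nseq z false); case: (word_gaps _) => y r /= Ep.
have {}Ew : gap_word s = nseq y false ++ gap_word (r ++ v).
  by rewrite gap_word_cat catA Ep -catA Euq.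
have y0 : y = 0 by case: y {Ep} Ew => //; case: (s).
have {y0 Ew} Es : s = r ++ v.
  move: Ew; rewrite y0 => /(congr1 word_gaps).
  by rewrite !gap_wordK => -[].
have Eu' : u = take (size u) (nseq z false ++ gap_word v).
  by rewrite Euq take_size_cat.
move: Eu; rewrite {1}Eu' take_cat size_nseq; case: (ltnP (size u) z) => [ltuz|lezu].
  by rewrite take_nseq ?density_nseq0 //; lia.
rewrite {1}/density count_cat -!/(density _) density_nseq0 add0n => Ek.
have ltkv : k < size v.
  rewrite -density_gap_word -Ek /density.
  by rewrite -{2}[gap_word v](cat_take_drop (size u - z)) count_cat leq_addr.
have : k < density (take (size u - z) (gap_word v)) by rewrite Ek.
rewrite density_take_gap_word // => ltku.
have ltks : k < size s by rewrite Es size_cat; lia.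
rewrite density_take_gap_word //.
have Ev : drop (size r) s = v by rewrite Es drop_size_cat.
have := Ns (size r) k; rewrite Ev {1}Es size_cat ltn_add2l => /(_ ltkv).
lia.
Qed.

Lemma prefix_normal_nseq0 n : prefix_normal (nseq n false).
Proof.
apply/prefix_normalP => u /infixP[p [q /(congr1 density)]].
by rewrite density_nseq0 /density !count_cat; lia.
Qed.

(** If the word began with 0, its factor [[:: true]] would beat the prefix of length 1. *)
Lemma prefix_normal_gapsP w : prefix_normal w -> 0 < density w ->
  exists2 s, w = gap_word s & gap_normal s.
Proof.
have := word_gapsK w; case: (word_gaps w) => [z s] /= <- Nw.
rewrite /density count_cat -!/(density _) density_nseq0 density_gap_word.
case: z Nw => [|z] Nw; first by exists s; rewrite // -prefix_normal_gap_word.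
case: s Nw => // a s /prefix_normalP/(_ [:: true]) Nw _.
suff /Nw : infix [:: true] (nseq z.+1 false ++ gap_word (a :: s)).
  by rewrite /density /= take0.
apply/infixP; exists (nseq z.+1 false), (nseq a false ++ gap_word s).
by [].
Qed.

(** * Calculus of generating functions of weighted sets *)

Local Open Scope ring_scope.

(* [f] is the generating function, by weight [wt], of the elements of [T] that
   satisfy [P]: [e n] enumerates those of weight [n]. *)
Definition has_gf (T : eqType) (P : pred T) (wt : T -> nat) (f : fps int) :=
  exists e : nat -> seq T, forall n,
    [/\ uniq (e n), e n =i [pred t | P t & wt t == n]
      & coefs f n = (size (e n))%:Z].

Lemma coefs_mulX (f : fps int) n :
  coefs (fpsX int * f) n = if n is m.+1 then coefs f m else 0.
Proof.
change (\sum_(i < n.+1) (i == 1 :> nat)%:R * coefs f (n - i)%N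
        = if n is m.+1 then coefs f m else 0).
case: n => [|n]; first by rewrite big_ord1 mul0r.
rewrite 2!big_ord_recl /= mul0r add0r mul1r subSS subn0.
by rewrite big1 ?addr0 // => i _; rewrite mul0r.
Qed.

Lemma coefs_mulXn (f : fps int) m n :
  coefs (fpsX int ^+ m * f) n = if (m <= n)%N then coefs f (n - m) else 0.
Proof.
elim: m n => [|m IHm] n; first by rewrite mul1r subn0.
by rewrite exprS -mulrA coefs_mulX; case: n.
Qed.

Section GeneratingFunctions.
Variables T U : eqType.
Implicit Types (P : pred T) (Q : pred U) (wt : T -> nat) (f g : fps int).

Lemma has_gf_image P Q wt (wt' : U -> nat) f (phi : T -> U) c :
  has_gf P wt f ->
  {in P &, injective phi} ->
  (forall u, reflect (exists2 t, P t & u = phi t) (Q u)) ->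
  (forall t, P t -> wt' (phi t) = wt t + c)%N ->
  has_gf Q wt' (fpsX int ^+ c * f).
Proof.
move=> [e He] phi_inj QP wtE.
exists (fun n => if (c <= n)%N then [seq phi t | t <- e (n - c)%N] else [::]) => n.
rewrite coefs_mulXn; have [lecn|ltnc] := leqP c n.
  have [e_uniq memE ->] := He (n - c)%N; rewrite size_map; split=> //.
    rewrite map_inj_in_uniq // => t t'.
    by rewrite !memE !inE => /andP[Pt _] /andP[Pt' _]; apply: phi_inj.
  move=> u; apply/mapP/andP => [[t] | [/QP[t Pt ->]]].
    rewrite memE inE => /andP[Pt /eqP wt_t] ->.
    split; first by apply/QP; exists t.
    by rewrite wtE // wt_t subnK.
  rewrite wtE // => /eqP wt_t; exists t => //.
  by rewrite memE !inE Pt -wt_t addnK eqxx.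
split=> // u; rewrite in_nil; apply/esym/andP => -[/QP[t Pt ->]].
by rewrite wtE // => /eqP; lia.
Qed.

(** This allows a constraint to be counted through its complement. *)
Lemma has_gf_diff P (Q : pred T) wt f g :
  has_gf P wt f -> has_gf [pred t | P t & ~~ Q t] wt g ->
  has_gf [pred t | P t & Q t] wt (f - g).
Proof.
move=> [e He] [e' He']; exists (fun n => filter Q (e n)) => n.
have [e_uniq memE szE] := He n; have [e'_uniq memE' szE'] := He' n.
split; first exact: filter_uniq.
  by move=> t; rewrite mem_filter memE !inE andbA [Q t && _]andbC.
have -> : coefs (f - g) n = coefs f n - coefs g n by [].
rewrite szE szE' -(count_predC Q) -!size_filter PoszD.
suff -> : size (e' n) = size (filter (predC Q) (e n)) by rewrite addrK.
apply/perm_size/uniq_perm => //; first exact: filter_uniq.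
move=> t; rewrite mem_filter memE' memE !inE.
by case: (P t); case: (Q t).
Qed.

Lemma has_gf_prod P Q wt (wt' : U -> nat) f g :
  has_gf P wt f -> has_gf Q wt' g ->
  has_gf [pred p : T * U | P p.1 & Q p.2] (fun p => wt p.1 + wt' p.2)%N (f * g).
Proof.
move=> [e He] [e' He'].
exists (fun n => [seq p | i <- iota 0 n.+1,
                         p <- [seq (t, u) | t <- e i, u <- e' (n - i)%N]]) => n.
split.
- apply: allpairs_uniq_dep => [|i _|]; first exact: iota_uniq.
    apply: allpairs_uniq; [by case: (He i) | by case: (He' (n - i)%N) |].
    by move=> [? ?] [? ?].
  (* Blocks for distinct [i] are disjoint, since [i] is recovered as the weight of the first
     component. *)
  move=> _ _ /allpairsPdep[i [p [_ pi ->]]] /allpairsPdep[j [q [_ + ->]]] /= pq.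
  rewrite -{}pq => /allpairsP[[t u] /= [tj _ Ep]].
  move: pi; rewrite {}Ep => /allpairsP[[t' u'] /= [ti _ [Et _]]].
  have [_ memEi _] := He i; have [_ memEj _] := He j.
  move: ti tj; rewrite -Et memEi memEj !inE.
  by move=> /andP[_ /eqP <-] /andP[_ /eqP <-].
- move=> [t u]; rewrite !inE; apply/allpairsPdep/andP.
    move=> [i [_ [+ /allpairsP[[t' u'] /= [+ + ->]] [-> ->]]]].
    have [_ -> _] := He i; have [_ -> _] := He' (n - i)%N.
    rewrite mem_iota !inE => lein /andP[-> /eqP wt_t] /andP[-> /eqP wt_u].
    by split=> //; rewrite wt_t wt_u; lia.
  move=> [/andP[Pt Qu] /eqP wt_tu]; exists (wt t), (t, u).
  have {}wt_tu : (wt t + wt' u = n)%N by [].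
  split=> //; first by rewrite mem_iota; lia.
  apply/allpairsP; exists (t, u); split=> //=.
    by have [_ -> _] := He (wt t); rewrite !inE Pt eqxx.
  by have [_ -> _] := He' (n - wt t)%N; rewrite !inE Qu -wt_tu addKn eqxx.
rewrite size_allpairs_dep sumnE big_map -[iota _ _]/(index_iota 0 n.+1).
rewrite big_mkord (big_morph Posz PoszD (erefl 0%:Z)).
apply: eq_bigr => i _; rewrite size_allpairs PoszM.
by have [_ _ ->] := He i; have [_ _ ->] := He' (n - i)%N.
Qed.

End GeneratingFunctions.

(** * From prefix normal words to gap sequences *)

Lemma pnw_series_gf d f :
  has_gf [pred w | prefix_normal w & density w == d] size f -> pnw_series d = f.
Proof.
move=> [e He]; apply: fpsP => n; have [e_uniq memE ->] := He n.
congr Posz; rewrite /pnw cardsE cardE -(size_map val).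
apply/perm_size/uniq_perm => //.
  by rewrite map_inj_uniq ?enum_uniq //; apply: val_inj.
move=> w; rewrite memE inE; apply/mapP/andP => [[u] | [Nw /eqP sz_w]].
  by rewrite mem_enum => ? ->; rewrite size_tuple.
have sz_w' : size w == n by apply/eqP.
by exists (Tuple sz_w'); rewrite // mem_enum.
Qed.

Lemma pnw_series_gaps d f : (0 < d)%N ->
  has_gf [pred s | gap_normal s & size s == d] sumn f ->
  pnw_series d = fpsX int ^+ d * f.
Proof.
move=> d_gt0 gf_s; apply: pnw_series_gf.
apply: (has_gf_image (phi := gap_word) gf_s).
- by move=> s t _ _ /(congr1 word_gaps); rewrite !gap_wordK => -[].
- move=> w; apply: (iffP andP) => [[Nw /eqP dw] | [s /andP[Ns ds] ->]].
    case: (prefix_normal_gapsP Nw) => [|s Ew Ns]; first by rewrite dw.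
    by exists s; rewrite // inE /= Ns -density_gap_word -Ew dw eqxx.
  by rewrite prefix_normal_gap_word density_gap_word.
by move=> s /andP[_ /eqP <-]; rewrite size_gap_word.
Qed.

(** * Elementary series: geometric, boolean, and triples under an inequality *)

Definition geom k : fps int := (1 - fpsX int ^+ k)^-1.

(** The indicator of the multiples of [k] is [k]-periodic, so subtracting its shift by [k] leaves
    only the coefficient at 0. *)
Lemma mul_geom_dvdn k : (0 < k)%N ->
  (1 - fpsX int ^+ k) * Series (fun n => (k %| n)%:R) = 1.
Proof.
move=> k_gt0; set h := Series _; apply: fpsP => n; rewrite mulrBl mul1r.
change (coefs h n - coefs (fpsX int ^+ k * h) n = (n == 0%N)%:R).
rewrite coefs_mulXn /=; case: leqP => [lekn|ltnk].
  rewrite -{1}(subnK lekn) dvdn_addl // subrr.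
  by case: n lekn => //; lia.
rewrite subr0; case: n ltnk => [|n] ltnk; first by rewrite dvdn0.
by rewrite gtnNdvd.
Qed.

Lemma geomE k : (0 < k)%N -> geom k = Series (fun n => (k %| n)%:R).
Proof. by move=> k_gt0; apply/mulr1_eq/mul_geom_dvdn. Qed.

Lemma geomK k : (0 < k)%N -> geom k * (1 - fpsX int ^+ k) = 1.
Proof. by move=> k_gt0; rewrite geomE // mulrC mul_geom_dvdn. Qed.

Lemma has_gf_geom k : (0 < k)%N -> has_gf predT (muln k) (geom k).
Proof.
move=> k_gt0; rewrite geomE //.
exists (fun n => if (k %| n)%N then [:: n %/ k]%N else [::]) => n /=.
case: ifPn => [/dvdnP[q ->]|ndvd]; split=> // i; rewrite !inE.
  by rewrite mulnK // mulnC eqn_pmul2r // eq_sym.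
by apply/esym/negbTE; apply: contraNneq ndvd => <-; apply: dvdn_mulr.
Qed.

Lemma has_gf_bool : has_gf predT nat_of_bool (1 + fpsX int).
Proof.
exists (fun n => if n is 0 then [:: false] else if n is 1 then [:: true] else [::]).
by move=> [|[|n]]; split=> // -[].
Qed.

(** On the complement, the substitution a = b + c + 1 + e turns the weight a + b + k c into e + 2 b
    + (k + 1) c + 1, whence the subtracted product and its factor x. *)
Lemma has_gf_le_add k : (0 < k)%N ->
  has_gf [pred p : nat * nat * nat | p.1.1 <= p.1.2 + p.2]%N
    (fun p => p.1.1 + p.1.2 + k * p.2)%N
    (geom 1 * geom 1 * geom k - fpsX int * (geom 1 * geom 2 * geom k.+1)).
Proof.
move=> k_gt0.
have gf1 := has_gf_geom (ltn0Sn 0).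
have gf_all := has_gf_prod (has_gf_prod gf1 gf1) (has_gf_geom k_gt0).
have gf_gt := has_gf_prod (has_gf_prod gf1 (has_gf_geom (ltn0Sn 1)))
                          (has_gf_geom (ltn0Sn k)).
set P := [pred p | _]; set wt := (fun _ => _).
(* Both terms take the form required by [has_gf_image], with shifts 0 and 1; the inserted 1 is
   [fpsX int ^+ 0]. *)
rewrite -[fpsX int * _]/(fpsX int ^+ 1 * _) -[X in has_gf _ _ (X - _)]mul1r.
apply: (has_gf_diff (P := predT)).
  apply: (has_gf_image (c := 0) (phi := id) gf_all) => // [p | [[a b] c] _].
    by apply: (iffP idP) => // _; exists p.
  by rewrite /wt /=; lia.
pose phi (p : nat * nat * nat) := ((p.1.2 + p.2 + 1 + p.1.1, p.1.2), p.2)%N.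
apply: (has_gf_image (phi := phi) gf_gt).
- by move=> [[a b] c] [[a' b'] c'] _ _ [] *; congr (_, _, _); lia.
- move=> [[a b] c]; apply: (iffP idP) => /= [gt_a | [[[a' b'] c'] _ [-> -> ->]]].
    by exists ((a - (b + c + 1), b), c)%N => //; congr (_, _, _); rewrite /=; lia.
  by lia.
by move=> [[a b] c] _; rewrite /wt /phi /=; lia.
Qed.

(** * Parametrizations for densities 0 to 6 *)

Lemma pnw_series_param (T : eqType) (P : pred T) wt f (phi : T -> seq nat) d :
  (0 < d)%N -> has_gf P wt f ->
  {in P &, injective phi} ->
  (forall t, P t -> gap_normal (phi t) && (size (phi t) == d)) ->
  (forall s, gap_normal s -> size s = d -> exists2 t, P t & s = phi t) ->
  (forall t, sumn (phi t) = wt t) ->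
  pnw_series d = fpsX int ^+ d * f.
Proof.
move=> d_gt0 gf_f phi_inj phiN phi_surj wtE; apply: pnw_series_gaps => //.
rewrite -[f]mul1r; apply: (has_gf_image (c := 0) gf_f phi_inj) => [s | t _].
  apply: (iffP andP) => [[Ns /eqP] | [t Pt ->]]; first exact: phi_surj.
  exact/andP/phiN.
by rewrite addn0.
Qed.

(** Nonempty words of zeros are not gap words, so the length itself is the parameter. *)
Lemma pnw_series0 : pnw_series 0 = geom 1.
Proof.
apply: pnw_series_gf; rewrite -[geom 1]mul1r.
apply: (has_gf_image (c := 0) (phi := fun n => nseq n false)
                     (has_gf_geom (ltn0Sn 0))) => [m n _ _ | w | n _].
- by move=> /(congr1 size); rewrite !size_nseq.
- apply: (iffP andP) => [[_ /eqP d0] | [n _ ->]].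
    exists (size w) => //; apply/all_pred1P.
    by move: d0; rewrite /density; elim: w => //= -[] w.
  by rewrite /= prefix_normal_nseq0 density_nseq0.
by rewrite size_nseq; lia.
Qed.

Lemma pnw_series1 : pnw_series 1 = fpsX int ^+ 1 * geom 1.
Proof.
apply: (pnw_series_param (phi := fun a => [:: a]) _ (has_gf_geom (ltn0Sn 0))) => //.
- by move=> a b _ _ [].
by move=> [|a [|? ?]] //= _ _; exists a.
Qed.

Lemma pnw_series2 : pnw_series 2 = fpsX int ^+ 2 * (geom 1 * geom 1).
Proof.
have gf1 := has_gf_geom (ltn0Sn 0).
apply: (pnw_series_param (phi := fun p => [:: p.1; p.2]) _
          (has_gf_prod gf1 gf1)) => //.
- by move=> [a b] [a' b'] _ _ /= [-> ->].
- by move=> [a b] _; rewrite /gap_normal /=; lia.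
- by move=> [|a [|b [|? ?]]] //= _ _; exists (a, b).
by move=> [a b] /=; lia.
Qed.

(** The minimum [m] enters every gap but the last, hence with weight 2; for density d the same
    reason gives [geom] of d - 1. The final [geom 1] counts the free gap [t]. *)
Lemma pnw_series3 : pnw_series 3 = fpsX int ^+ 3 * (geom 2 * geom 1 * geom 1).
Proof.
have gf1 := has_gf_geom (ltn0Sn 0).
pose phi (p : nat * nat * nat) := let: (m, a, t) := p in [:: m; m + a; t]%N.
apply: (pnw_series_param (phi := phi) _
          (has_gf_prod (has_gf_prod (has_gf_geom (ltn0Sn 1)) gf1) gf1)) => //.
- by move=> [[m a] t] [[m' a'] t'] _ _ [] *; congr (_, _, _); lia.
- by move=> [[m a] t] _; rewrite /gap_normal /=; lia.
- move=> [|m [|a [|t [|? ?]]]] //= Ns _; exists (m, (a - m)%N, t) => //=.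
  by move: Ns; rewrite /gap_normal /= => Ns; congr [:: _; _; _]; lia.
by move=> [[m a] t] /=; lia.
Qed.

Lemma pnw_series4 :
  pnw_series 4 = fpsX int ^+ 4 * (geom 3 * geom 1 * geom 1 * geom 1).
Proof.
have gf1 := has_gf_geom (ltn0Sn 0).
pose phi (p : nat * nat * nat * nat) :=
  let: (m, a, b, t) := p in [:: m; m + a; m + b; t]%N.
apply: (pnw_series_param (phi := phi) _
  (has_gf_prod (has_gf_prod (has_gf_prod (has_gf_geom (ltn0Sn 2)) gf1) gf1) gf1))
  => //.
- by move=> [[[m a] b] t] [[[m' a'] b'] t'] _ _ [] *; congr (_, _, _, _); lia.
- by move=> [[[m a] b] t] _; rewrite /gap_normal /=; lia.
- move=> [|m [|a [|b [|t [|? ?]]]]] //= Ns _.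
  exists (m, (a - m)%N, (b - m)%N, t) => //=.
  by move: Ns; rewrite /gap_normal /= => Ns; congr [:: _; _; _; _]; lia.
by move=> [[[m a] b] t] /=; lia.
Qed.

Lemma pnw_series5 : pnw_series 5 = fpsX int ^+ 5 *
  (geom 4 * (geom 1 * geom 1 * geom 1 - fpsX int * (geom 1 * geom 2 * geom 2))
   * geom 1).
Proof.
have gf1 := has_gf_geom (ltn0Sn 0).
pose phi (p : nat * (nat * nat * nat) * nat) :=
  let: (m, (a, b, c), t) := p in [:: m; m + a; m + b; m + c; t]%N.
apply: (pnw_series_param (phi := phi) _
  (has_gf_prod (has_gf_prod (has_gf_geom (ltn0Sn 3)) (has_gf_le_add (ltn0Sn 0)))
               gf1)) => //.
- move=> [[m [[a b] c]] t] [[m' [[a' b'] c']] t'] _ _ [] *.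
  by congr (_, (_, _, _), _); lia.
- by move=> [[m [[a b] c]] t]; rewrite /gap_normal /=; lia.
- move=> [|m [|a [|b [|c [|t [|? ?]]]]]] //= Ns _.
  move: Ns; rewrite /gap_normal /= => Ns.
  exists (m, (a - m, b - m, c - m), t)%N => /=; first by lia.
  by congr [:: _; _; _; _; _]; lia.
by move=> [[m [[a b] c]] t] /=; lia.
Qed.

Lemma pnw_series6 : pnw_series 6 = fpsX int ^+ 6 *
  (geom 5 * (geom 1 * geom 1 * geom 2 - fpsX int * (geom 1 * geom 2 * geom 3))
   * (geom 1 * (1 + fpsX int)) * geom 1).
Proof.
have gf1 := has_gf_geom (ltn0Sn 0).
(* [l] is min(b_3, b_5); the difference b_5 - b_3 is e + 1 if [r], else -e. *)
pose phi (p : nat * (nat * nat * nat) * (nat * bool) * nat) :=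
  let: (m, (a, c, l), (e, r), t) := p in
  [:: m; m + a; m + l + (if r then 0 else e); m + c;
      m + l + (if r then e.+1 else 0); t]%N.
apply: (pnw_series_param (phi := phi) _
  (has_gf_prod (has_gf_prod
     (has_gf_prod (has_gf_geom (ltn0Sn 4)) (has_gf_le_add (ltn0Sn 1)))
     (has_gf_prod gf1 has_gf_bool)) gf1)) => //.
- move=> [[[m [[a c] l]] [e r]] t] [[[m' [[a' c'] l']] [e' r']] t'] _ _.
  by case: r; case: r' => -[] *; congr (_, (_, _, _), (_, _), _); lia.
- by move=> [[[m [[a c] l]] [e []]] t]; rewrite /gap_normal /=; lia.
- move=> [|m [|a [|b [|c [|d [|t [|? ?]]]]]]] //= Ns _.
  move: Ns; rewrite /gap_normal /= => Ns.
  (* Equality [b = d] is encoded once, by [e = 0] and [r = false]. In both cases the difference adds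
     [e + r] to the weight, which gives the factor [geom 1 * (1 + fpsX int)]. *)
  have [ltbd|ledb] := ltnP b d.
    exists (m, (a - m, c - m, b - m), (d - b.+1, true), t)%N => /=; first by lia.
    by congr [:: _; _; _; _; _; _]; lia.
  exists (m, (a - m, c - m, d - m), (b - d, false), t)%N => /=; first by lia.
  by congr [:: _; _; _; _; _; _]; lia.
by move=> [[[m [[a c] l]] [e []]] t] /=; lia.
Qed.

(** * Closed forms by ring identities *)

Theorem lemma3 :
  let f : nat -> fps int := pnw_series in
  let x : fps int := fpsX int in
     f 0%N = 1 / (1 - x)
  /\ f 1%N = x / (1 - x)
  /\ f 2%N = x ^+ 2 / (1 - x) ^+ 2
  /\ f 3%N = x ^+ 3 / ((1 - x ^+ 2) * (1 - x) ^+ 2)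
  /\ f 4%N = x ^+ 4 / ((1 - x ^+ 3) * (1 - x) ^+ 3)
  /\ f 5%N = x ^+ 5 * (1 + x + x ^+ 2)
             / ((1 - x ^+ 4) * (1 - x ^+ 2) ^+ 2 * (1 - x) ^+ 2)
  /\ f 6%N = x ^+ 6 * (1 + x + x ^+ 2 + x ^+ 3)
             / ((1 - x ^+ 5) * (1 - x ^+ 3) * (1 - x ^+ 2) * (1 - x) ^+ 3).
Proof.
move=> f x; rewrite {}/f pnw_series0 pnw_series1 pnw_series2 pnw_series3.
rewrite pnw_series4 pnw_series5 pnw_series6 -/x.
have E k : (0 < k)%N -> geom k * (1 - x ^+ k) = 1.
  exact: geomK.
move: (E 1 isT) (E 2 isT) (E 3 isT) (E 4 isT) (E 5 isT) => {E}.
(* From here only the equations [geom k * (1 - x ^+ k) = 1] matter, so the series become variables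
   for [ring]. *)
move: (geom 1) (geom 2) (geom 3) (geom 4) (geom 5) x => g1 g2 g3 g4 g5 x.
rewrite expr1 => E1 E2 E3 E4 E5.
have g12 : g1 = (1 + x) * g2.
  transitivity (g1 * (g2 * (1 - x ^+ 2))); first by rewrite E2 mulr1.
  by transitivity ((1 + x) * g2 * (g1 * (1 - x))); [ring | rewrite E1 mulr1].
have g13 : g1 = (1 + x + x ^+ 2) * g3.
  transitivity (g1 * (g3 * (1 - x ^+ 3))); first by rewrite E3 mulr1.
  by transitivity ((1 + x + x ^+ 2) * g3 * (g1 * (1 - x)));
     [ring | rewrite E1 mulr1].
have divE (a D G b : fps int) : D * G = 1 -> b = a * G -> b = a / D.
  by move=> /mulr1_eq -> ->.
split; [|split; [|split; [|split; [|split; [|split]]]]].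
- by apply: (divE _ _ g1); rewrite ?mul1r // mulrC.
- by apply: (divE _ _ g1) => //; rewrite mulrC.
- apply: (divE _ _ (g1 * g1)); last by ring.
  transitivity ((g1 * (1 - x)) ^+ 2); first by ring.
  by rewrite E1 expr1n.
- apply: (divE _ _ (g2 * g1 * g1)); last by ring.
  transitivity ((g2 * (1 - x ^+ 2)) * (g1 * (1 - x)) ^+ 2); first by ring.
  by rewrite E1 E2 expr1n mulr1.
- apply: (divE _ _ (g3 * g1 * g1 * g1)); last by ring.
  transitivity ((g3 * (1 - x ^+ 3)) * (g1 * (1 - x)) ^+ 3); first by ring.
  by rewrite E1 E3 expr1n mulr1.
- apply: (divE _ _ (g4 * g2 ^+ 2 * g1 ^+ 2)).
    transitivity ((g4 * (1 - x ^+ 4)) * (g2 * (1 - x ^+ 2)) ^+ 2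
                  * (g1 * (1 - x)) ^+ 2); first by ring.
    by rewrite E1 E2 E4 !expr1n !mulr1.
  (* The numerator arises as (1 + x)^2 - x = 1 + x + x^2. *)
  by rewrite g12; ring.
apply: (divE _ _ (g5 * g3 * g2 * g1 ^+ 3)).
  transitivity ((g5 * (1 - x ^+ 5)) * (g3 * (1 - x ^+ 3)) * (g2 * (1 - x ^+ 2))
                * (g1 * (1 - x)) ^+ 3); first by ring.
  by rewrite E1 E2 E3 E5 !expr1n !mulr1.
(* Here g1 - x g3 = (1 + x^2) g3, and the factor 1 + x completes the numerator: (1 + x)(1 + x^2) = 1
   + x + x^2 + x^3. *)
by rewrite g13; ring.
Qed.
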